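(* Let $f\colon\mathbb N\to\mathbb C$ and $q\in\mathbb C$ be such that the product $\prod_{n=1}^\infty(1-f(n)q^n)^{-1}$ converges absolutely. Then $$\prod_{n=1}^{\infty}(1-f(n)q^n)^{-1}=\sum_{\lambda\in\mathcal S}q^{\operatorname{lg}(\lambda)}\prod_{i\ge1}f(i)^{(\lambda_i-\lambda_{i+1})/i}.$$
   Context: A partition $\lambda=(\lambda_1,\dots,\lambda_r)$, $\lambda_1\ge\dots\ge\lambda_r\ge1$, is called sequentially congruent if $\lambda_i\equiv\lambda_{i+1}\pmod i$ for $1\le i\le r-1$ and $\lambda_r\equiv0\pmod r$; the empty partition is included. $\mathcal S$ is the set of sequentially congruent partitions. $\operatorname{lg}(\lambda)=\lambda_1$ is the largest part (with $\operatorname{lg}(\emptyset)=0$), and by convention $\lambda_k=0$ for $k>\ell(\lambda)=r$.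
   Formalization: The formal theorem also assumes |f(n)q^n| < 1 for all n ≥ 1; without it the claim fails (q = 1, f(1) = 2, f(n) = 0 for n ≥ 2: the product is −1, the sum diverges), and the sum converges only under this condition. *)

(* Defs.v *)
From mathcomp Require Import all_boot all_order all_algebra.
From mathcomp Require Import finmap complex.
From mathcomp Require Import all_classical all_reals all_analysis.
From mathcomp Require Import summability.
Import Order.TTheory GRing.Theory Num.Theory.
Import numFieldNormedType.Exports.

Set Implicit Arguments.
Unset Strict Implicit.
Unset Printing Implicit Defensive.

Local Open Scope classical_set_scope.
Local Open Scope ring_scope.

Definition is_partition (s : seq nat) : bool := sorted geq s && (0%N \notin s).

(* Parts are numbered from 1, and part s k = 0 for k > size s. The junk value
   part s 0 = part s 1 is only ever read for s = [::], where it is 0. *)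
Definition part (s : seq nat) (k : nat) : nat := nth 0%N s k.-1.

Definition seq_congruent (s : seq nat) : bool :=
  [&& is_partition s,
      all (fun i => part s i == part s i.+1 %[mod i]) (iota 1 (size s).-1)
    & part s (size s) == 0 %[mod size s]].

Definition seqcong : Type := {s : seq nat | seq_congruent s}.

Definition lg (s : seq nat) : nat := part s 1.

Section products.
Variable C : numFieldType.
Implicit Type u : nat -> C.

Definition partial_prod u (N : nat) : C := \prod_(1 <= n < N.+1) u n.

(* \prod_(n >= 1) u n is absolutely convergent when, writing u n = 1 + a n,
   the product of the 1 + |a n| converges; its partial products are
   nondecreasing and >= 1, so the limit cannot be 0. *)
Definition abs_cvg_prod u : Prop :=
  cvgn (partial_prod (fun n => 1 + `|u n - 1|)).

Definition inf_prod u : C := limn (partial_prod u).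

(* Only i <= size s contribute: for i > size s the exponent is 0. For s
   sequentially congruent the division by i is exact. *)
Definition weight (f : nat -> C) (q : C) (s : seq nat) : C :=
  q ^+ lg s *
  \prod_(1 <= i < (size s).+1) f i ^+ ((part s i - part s i.+1) %/ i)%N.

End products.

(* Main.v *)
Require Import Defs.
From mathcomp Require Import all_boot all_order all_algebra.
From mathcomp Require Import finmap complex.
From mathcomp Require Import all_classical all_reals all_analysis.
From mathcomp Require Import summability.
From mathcomp Require Import ring lra.
Import Order.TTheory GRing.Theory Num.Theory.
Import numFieldNormedType.Exports.
Local Open Scope classical_set_scope.
Local Open Scope ring_scope.

Set Implicit Arguments.
Unset Strict Implicit.
Unset Printing Implicit Defensive.

(* A sequentially congruent partition l amounts to a finitely supported sequence
   of exponents e_i = (l_i - l_{i+1}) / i, since l_i is the sum of j e_j over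
   j >= i.  As lg(l) is the sum of all i e_i, the term of l is the product of the
   (f(i) q^i)^{e_i}, so the sum over all l with at most N parts and exponents at
   most K is a product of N truncated geometric series.  Absolute convergence of
   the product bounds the products of the 1 / (1 - |f(n) q^n|), hence the sums of
   absolute values of the terms, and the sum over partitions exists; letting K,
   then N, tend to infinity along these boxes identifies it with the product. *)

(** * Partitions described by their parts *)

Lemma geq_trans : transitive geq.
Proof. by move=> x y z /= h1 h2; apply: leq_trans h2 h1. Qed.

(** In a nonincreasing sequence the zeros come last, so dropping them only replaces entries by the
    default 0. *)
Lemma nth_filter_neq0 (s : seq nat) (i : nat) :
  sorted geq s -> nth 0%N [seq x <- s | x != 0%N] i = nth 0%N s i.
Proof.
elim: s i => [|x s IHs] i //= sx; have ss := path_sorted sx.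
have [x0|x_neq0] /= := eqVneq x 0%N; last by case: i => //= i; exact: IHs.
move: sx; rewrite x0 (path_sortedE geq_trans) => /andP[/allP s0 _].
have nth0 j : nth 0%N s j = 0%N.
  have [/(mem_nth 0%N)/s0|?] := ltnP j (size s); last by rewrite nth_default.
  by rewrite /= leqn0 => /eqP.
by rewrite IHs // nth0; case: i => //= i; rewrite nth0.
Qed.

Lemma part_nonincreasing (s : seq nat) (i : nat) :
  is_partition s -> (part s i.+2 <= part s i.+1)%N.
Proof.
move=> /andP[ss _]; rewrite /part /=.
have [si|si] := leqP (size s) i.+1; first by rewrite nth_default.
by apply: (sorted_ltn_nth geq_trans 0%N ss); rewrite ?inE // ltnW.
Qed.

Lemma part_le_lg (s : seq nat) (i : nat) :
  is_partition s -> (part s i.+1 <= lg s)%N.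
Proof.
move=> ps; elim: i => // i; apply: leq_trans; exact: part_nonincreasing.
Qed.

Lemma partition_ext (s t : seq nat) : is_partition s -> is_partition t ->
  (forall i, part s i.+1 = part t i.+1) -> s = t.
Proof.
rewrite /part /=.
(* As no part is 0, the parts determine the length. *)
have lt_size (u : seq nat) i :
    is_partition u -> (i < size u)%N = (nth 0%N u i != 0%N).
  move=> /andP[_ u0]; have [ui|?] := ltnP; last by rewrite nth_default.
  by apply/esym; apply: contra u0 => /eqP <-; exact: mem_nth.
move=> ps pt st; apply: (@eq_from_nth _ 0%N) => [|i _]; last exact: st.
have {}lt_size i : (i < size s)%N = (i < size t)%N by rewrite !lt_size ?st.
apply/eqP; rewrite eqn_leq.
by rewrite leqNgt lt_size ltnn /= leqNgt -lt_size ltnn.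
Qed.

(** Parts past the end read as 0, so at [i.+1 = size s] the difference is the last part, and the
    final congruence becomes one more divisibility. *)
Lemma seq_congruentP (s : seq nat) :
  reflect (is_partition s /\ forall i, (i.+1 %| part s i.+1 - part s i.+2)%N)
          (seq_congruent s).
Proof.
have modE i : is_partition s -> (part s i.+1 == part s i.+2 %[mod i.+1]) =
    (i.+1 %| part s i.+1 - part s i.+2)%N.
  by move=> ps; rewrite eqn_mod_dvd //; exact: part_nonincreasing.
apply: (iffP and3P) => [[ps /allP cs c0]|[ps cs]]; split=> //.
- move=> i; case: (ltngtP i.+1 (size s)) => si.
  + by rewrite -modE // cs // mem_iota /=; case: (size s) si.
  + by rewrite /part /= !nth_default // ltnW.
  + rewrite {2}/part [nth _ _ _.+2.-1]nth_default /= ?si // subn0.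
    by move: c0; rewrite -si mod0n.
- apply/allP => -[|i]; rewrite mem_iota //= => _; by rewrite modE.
- case ss : (size s) => [|n]; first by rewrite /part nth_default ?ss.
  have := cs n; rewrite {2}/part [nth _ _ _.+2.-1]nth_default /= ?ss // subn0.
  by rewrite /dvdn mod0n.
Qed.

(** * Partitions and exponent sequences *)

(* Indices of exponents start at 0, those of parts at 1. *)
Definition mult (s : seq nat) (i : nat) : nat :=
  ((part s i.+1 - part s i.+2) %/ i.+1)%N.

Definition tail_sum (N : nat) (e : nat -> nat) (i : nat) : nat :=
  (\sum_(i <= j < N) j.+1 * e j)%N.

Lemma tail_sum_recl (N : nat) (e : nat -> nat) (i : nat) : (i < N)%N ->
  tail_sum N e i = (i.+1 * e i + tail_sum N e i.+1)%N.
Proof. exact: big_ltn. Qed.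

Lemma tail_sum_geq (N : nat) (e : nat -> nat) (i : nat) : (N <= i)%N ->
  tail_sum N e i = 0%N.
Proof. by move=> Ni; rewrite /tail_sum big_geq. Qed.

Lemma tail_sum_mult (N : nat) (s : seq nat) (i : nat) :
  seq_congruent s -> (size s <= N)%N -> tail_sum N (mult s) i = part s i.+1.
Proof.
move=> /seq_congruentP[ps cs] sN.
have [Ni|/ltnW iN] := leqP N i.
  by rewrite tail_sum_geq // /part nth_default //; exact: leq_trans Ni.
(* Descending induction from [i = N], where both sides are 0. *)
have -> : i = (N - (N - i))%N by rewrite subKn.
elim: (N - i)%N (leq_subr i N) => [_|k IHk kN].
  by rewrite subn0 tail_sum_geq // /part nth_default.
have kE := subnSK kN.
rewrite tail_sum_recl; last by rewrite kE leq_subr.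
rewrite kE IHk ?(ltnW kN) // -kE mulnC divnK //.
by rewrite subnK // part_nonincreasing.
Qed.

(** The tail sums vanish after the last nonzero exponent below [N]; a partition must not keep these
    zeros. *)
Definition partition_of (N : nat) (e : nat -> nat) : seq nat :=
  [seq x <- mkseq (tail_sum N e) N | x != 0%N].

Lemma sorted_tail_sum (N : nat) (e : nat -> nat) :
  sorted geq (mkseq (tail_sum N e) N).
Proof.
apply/(sortedP 0%N) => i; rewrite size_mkseq => iN.
rewrite !nth_mkseq ?(ltnW iN) //=.
by rewrite [leqRHS]tail_sum_recl ?(ltnW iN) // leq_addl.
Qed.

Lemma part_partition_of (N : nat) (e : nat -> nat) (i : nat) :
  part (partition_of N e) i.+1 = tail_sum N e i.
Proof.
rewrite /part nth_filter_neq0 ?sorted_tail_sum //=.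
have [iN|Ni] := ltnP i N; first by rewrite nth_mkseq.
by rewrite nth_default ?size_mkseq // tail_sum_geq.
Qed.

Lemma seq_congruent_partition_of (N : nat) (e : nat -> nat) :
  seq_congruent (partition_of N e).
Proof.
apply/seq_congruentP; split.
  rewrite /is_partition mem_filter /= andbT.
  by rewrite sorted_filter ?sorted_tail_sum //; exact: geq_trans.
move=> i; rewrite !part_partition_of; have [iN|Ni] := ltnP i N.
  by rewrite tail_sum_recl // addnK dvdn_mulr.
by rewrite !tail_sum_geq // leqW.
Qed.

Lemma mult_partition_of (N : nat) (e : nat -> nat) (i : nat) : (i < N)%N ->
  mult (partition_of N e) i = e i.
Proof.
by move=> iN; rewrite /mult !part_partition_of tail_sum_recl // addnK mulKn.
Qed.

Lemma partition_of_mult (N : nat) (s : seq nat) :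
  seq_congruent s -> (size s <= N)%N -> partition_of N (mult s) = s.
Proof.
move=> cs sN; apply: partition_ext.
- by case/seq_congruentP: (seq_congruent_partition_of N (mult s)).
- by case/seq_congruentP: cs.
- by move=> i; rewrite part_partition_of tail_sum_mult.
Qed.

Lemma eq_partition_of (N : nat) (e e' : nat -> nat) :
  (forall i, (i < N)%N -> e i = e' i) -> partition_of N e = partition_of N e'.
Proof.
move=> ee'; rewrite /partition_of; congr [seq x <- _ | _].
by apply: eq_mkseq => i; apply: eq_big_nat => j /andP[_ /ee' ->].
Qed.

Lemma size_partition_of (N : nat) (e : nat -> nat) :
  (size (partition_of N e) <= N)%N.
Proof. by rewrite size_filter (leq_trans (count_size _ _)) ?size_mkseq. Qed.

Lemma mult_le_lg (s : seq nat) (i : nat) : seq_congruent s ->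
  (mult s i <= lg s)%N.
Proof.
case/seq_congruentP => ps _; apply: leq_trans (leq_div _ _) _.
by apply: leq_trans (leq_subr _ _) _; exact: part_le_lg.
Qed.

(** The largest part is the tail sum from 0, which distributes the power of [q] over the factors.
    Leaving [N] free gives one formula for a whole box of partitions. *)
Lemma weightE (C : numFieldType) (f : nat -> C) (q : C) (N : nat)
    (s : seq nat) : seq_congruent s -> (size s <= N)%N ->
  weight f q s = \prod_(i < N) (f i.+1 * q ^+ i.+1) ^+ mult s i.
Proof.
move=> cs sN; rewrite /weight /lg -(tail_sum_mult 0 cs sN) /tail_sum.
rewrite expr_sum [X in X * _]big_mkord.
rewrite big_add1 /= (big_mkord xpredT (fun i => f i.+1 ^+ mult s i)).
rewrite (big_ord_widen N (fun i => f i.+1 ^+ mult s i)) //.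
rewrite [X in _ * X]big_mkcond /=.
rewrite -big_split; apply: eq_bigr => i _ /=.
rewrite exprMn exprM mulrC; case: ltnP => // si.
by rewrite /mult /part !nth_default ?(leqW si) //= div0n !expr0.
Qed.

(** * Finite sums over boxes of exponents *)

Lemma partial_sumE (I : choiceType) (V : zmodType) (x : I -> V) (A : {fset I}) :
  partial_sum x A = \sum_(i <- A) x i.
Proof. by rewrite /partial_sum [RHS]big_seq_fsetE. Qed.

Definition ext_ffun (N K : nat) (e : {ffun 'I_N -> 'I_K.+1}) (i : nat) : nat :=
  oapp (fun j : 'I_N => e j : nat) 0%N (insub i).

Lemma ext_ffunE (N K : nat) (e : {ffun 'I_N -> 'I_K.+1}) (i : 'I_N) :
  ext_ffun e i = e i.
Proof. by rewrite /ext_ffun valK. Qed.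

Definition seqcong_of (N : nat) (e : nat -> nat) : seqcong :=
  exist _ (partition_of N e) (seq_congruent_partition_of N e).

(** [K] bounds the exponents, not the parts. Finite functions are what the expansion of a product of
    sums runs over. *)
Definition box (N K : nat) : {fset seqcong} :=
  [fset seqcong_of N (ext_ffun e) | e : {ffun 'I_N -> 'I_K.+1}]%fset.

Lemma mem_box (N K : nat) (l : seqcong) :
  (size (val l) <= N)%N -> (lg (val l) <= K)%N -> l \in box N K.
Proof.
move=> lN lK; apply/imfsetP.
pose e := [ffun i : 'I_N => inord (mult (val l) i) : 'I_K.+1].
exists e; first by rewrite inE.
apply: val_inj; apply: etrans (esym (partition_of_mult (valP l) lN)) _.
apply: eq_partition_of => i iN.
have := ext_ffunE e (Ordinal iN); rewrite ffunE inordK => [-> //|].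
by rewrite ltnS; apply: leq_trans lK; exact: mult_le_lg (valP l).
Qed.

Lemma fset_bounded (I : choiceType) (F : I -> nat) (A : {fset I}) :
  exists M : nat, forall x, x \in A -> (F x <= M)%N.
Proof.
exists (\max_(x <- A) F x)%N => x xA.
exact: (leq_bigmax_seq (F := F)).
Qed.

(** Boxes are cofinal among finite sets, so a limit along [totally] can be computed on them. *)
Lemma fsubset_box (A : {fset seqcong}) :
  exists M : nat, forall N K, (M <= N)%N -> (M <= K)%N -> (A `<=` box N K)%fset.
Proof.
pose F (l : seqcong) := (size (val l) + lg (val l))%N.
have [M AM] := fset_bounded F A.
exists M => N K MN MK; apply/fsubsetP => l /AM lM.
apply: mem_box; [apply: leq_trans MN | apply: leq_trans MK].
  by apply: leq_trans lM; exact: leq_addr.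
by apply: leq_trans lM; exact: leq_addl.
Qed.

Lemma partial_sum_imfset (I : finType) (J : choiceType) (V : zmodType)
    (h : I -> J) (F : J -> V) : injective h ->
  partial_sum F [fset h i | i : I]%fset = \sum_i F (h i).
Proof.
move=> h_inj; rewrite partial_sumE big_imfset /=; last by move=> x y _ _ /h_inj.
by rewrite big_enum.
Qed.

(** Distributivity; no partition is counted twice, as [mult] recovers the exponents. With [a] and
    [F] general, this applies to the terms and to their absolute values. *)
Lemma sum_box (C : numFieldType) (a : nat -> C) (F : seqcong -> C) (N K : nat) :
  (forall l : seqcong, (size (val l) <= N)%N ->
    F l = \prod_(i < N) a i ^+ mult (val l) i) ->
  partial_sum F (box N K) = \prod_(i < N) \sum_(k < K.+1) a i ^+ k.
Proof.
move=> FE; rewrite /box partial_sum_imfset.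
  rewrite bigA_distr_bigA; apply: eq_bigr => e _.
  rewrite FE; last exact: size_partition_of.
  by apply: eq_bigr => i _; rewrite mult_partition_of // ext_ffunE.
move=> e e' ee'; apply/ffunP => i; apply: val_inj => /=.
have := congr1 (fun l : seqcong => mult (val l) i) ee'.
by rewrite !mult_partition_of // !ext_ffunE.
Qed.

(* Unordered sums with bounded absolute sums *)
#[local] Existing Instance totally_filter.

Lemma partial_sumD (I : choiceType) (V : zmodType) (x : I -> V)
    (A B : {fset I}) : (A `<=` B)%fset ->
  partial_sum x B = partial_sum x A + partial_sum x (B `\` A)%fset.
Proof.
move=> AB; rewrite !partial_sumE (big_fsetID _ (mem A)) /=.
congr (_ + _); apply: eq_fbigl => i; rewrite !inE /= ?(andbC (i \in B)) //.
by apply: andb_idr; exact: (fsubsetP AB).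
Qed.

Lemma ler_partial_sum (I : choiceType) (C : numDomainType) (x : I -> C)
    (A B : {fset I}) : (forall i, 0 <= x i) -> (A `<=` B)%fset ->
  partial_sum x A <= partial_sum x B.
Proof.
move=> x_ge0 /(partial_sumD x) ->; rewrite lerDl.
by apply: sumr_ge0 => i _.
Qed.

Lemma ler_norm_partial_sum (I : choiceType) (C : numDomainType) (x : I -> C)
    (A : {fset I}) :
  `|partial_sum x A| <= partial_sum (fun i => `|x i|) A.
Proof. exact: ler_norm_sum. Qed.

Lemma near_totally (I : choiceType) (P : set {fset I}) :
  (\forall A \near totally, P A) <->
  exists A0, forall A, (A0 `<=` A)%fset -> P A.
Proof. by split=> [[A0 _ ?]|[A0 ?]]; exists A0. Qed.

(** Cauchy criterion: once the absolute sum over [A0] is within [e] of the supremum, enlarging [A0]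
    changes the sum by less than [e]. *)
Lemma bounded_sums_cvg_real (I : choiceType) (R : realType) (x : I -> R)
    (M : R) :
  (forall A : {fset I}, partial_sum (fun i => `|x i|) A <= M) ->
  cvg (partial_sum x @ totally).
Proof.
move=> xM; apply: cauchy_cvg; apply: cauchy_exP => e e_gt0.
pose E := range (partial_sum (fun i => `|x i|)).
have supE : has_sup E.
  by split; [exists (partial_sum (fun i => `|x i|) fset0), fset0|
             exists M => _ [A _ <-]].
have [_ [A0 _ <-] A0e] := sup_adherent e_gt0 supE.
exists (partial_sum x A0); apply/near_totally; exists A0 => A A0A.
rewrite /ball /= (partial_sumD x A0A) opprD addNKr normrN.
apply: le_lt_trans (ler_norm_partial_sum _ _) _.
have : partial_sum (fun i => `|x i|) A <= sup E.
  by apply: ub_le_sup; [case: supE|exists A].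
by rewrite (partial_sumD _ A0A); lra.
Qed.

(** * Geometric series *)

Lemma subr_norm_lt1_neq0 (K : numFieldType) (a : K) : `|a| < 1 -> 1 - a != 0.
Proof.
by move=> a1; rewrite subr_eq0; apply: contraTneq a1 => <-; rewrite normr1 ltxx.
Qed.

Lemma sum_geometric (K : numFieldType) (a : K) (n : nat) : `|a| < 1 ->
  \sum_(k < n) a ^+ k = (1 - a ^+ n) / (1 - a).
Proof.
move=> /subr_norm_lt1_neq0 a_neq1.
apply: (mulfI a_neq1); rewrite mulrCA divff // mulr1.
by rewrite -opprB mulNr -subrX1 opprB.
Qed.

(** That the powers tend to 0 is a separate hypothesis, since it can fail for [|z| < 1] in a
    non-archimedean field. *)
Lemma cvg_sum_geometric (K : numFieldType) (z : K) : `|z| < 1 ->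
  (fun n => z ^+ n) @ \oo --> 0 ->
  (fun n => \sum_(k < n.+1) z ^+ k) @ \oo --> (1 - z)^-1.
Proof.
move=> z1 zn0; have zE : (1 - z)^-1 = (1 - 0) / (1 - z) by rewrite subr0 mul1r.
rewrite (_ : (fun n => _) = fun n => (1 - z ^+ n.+1) / (1 - z)); last first.
  by apply/funext => n; exact: sum_geometric.
rewrite [X in _ --> X]zE; apply: cvgM; last exact: cvg_cst.
apply: cvgB; first exact: cvg_cst.
by rewrite (cvg_shiftS (fun n => z ^+ n)).
Qed.

(** * From real to complex convergence *)

Section complex.
Variable R : realType.
Local Notation C := (R[i] : numFieldType).
Implicit Types (z : C) (r : R).

Lemma normc_real r : `|r%:C%C : C| = `|r|%:C%C.
Proof. by rewrite normc_def /= expr0n /= addr0 sqrtr_sqr. Qed.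

Lemma Re_normK z : (complex.Re `|z|)%:C%C = `|z|.
Proof. by rewrite RRe_real // normr_real. Qed.

Lemma Re_norm_ge0 z : 0 <= complex.Re `|z|.
Proof. by have := normr_ge0 z; rewrite lecE => /andP[]. Qed.

Lemma Re_norm_lt1 z : `|z| < 1 -> complex.Re `|z| < 1.
Proof. by rewrite ltcE => /andP[]. Qed.

Lemma real_complex_sum (J : Type) (s : seq J) (F : J -> R) :
  \sum_(i <- s) (F i)%:C%C = (\sum_(i <- s) F i)%:C%C :> C.
Proof. by rewrite [RHS]rmorph_sum. Qed.

Lemma cvg_real_complex (T : Type) (F : set_system T) (FF : Filter F)
    (u : T -> R) (r : R) : u @ F --> r ->
  (fun t => (u t)%:C%C : C) @ F --> (r%:C%C : C).
Proof.
move=> /cvgrPdist_le ur; apply/cvgrPdist_le => e e_gt0.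
have eE : (complex.Re e)%:C%C = e by rewrite RRe_real // ger0_real // ltW.
have Re_gt0 : 0 < complex.Re e by move: e_gt0; rewrite ltcE => /andP[].
apply: filterS (ur _ Re_gt0) => t rt.
by rewrite -rmorphB normc_real -eE lecR.
Qed.

(** Multiplication by ['i] turns the imaginary part into a real part, up to sign, and keeps the
    modulus. *)
Lemma normc_ge_Im z : `|complex.Im z|%:C%C <= `|z|.
Proof.
rewrite -normrN -ReiNIm; apply: le_trans (normc_ge_Re _) _.
rewrite normrM [X in _ * X]normc_def /= expr0n /= add0r expr1n sqrtr1.
by rewrite mulr1.
Qed.

Lemma bounded_sums_cvg (I : choiceType) (x : I -> C) (M : R) :
  (forall A : {fset I}, partial_sum (fun i => `|x i|) A <= M%:C%C) ->
  cvg (partial_sum x @ totally).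
Proof.
move=> xM.
have part_cvg (p : C -> R) : (forall z, `|p z|%:C%C <= `|z|) ->
    cvg (partial_sum (p \o x) @ totally).
  move=> ple; apply: (@bounded_sums_cvg_real _ _ _ M) => A.
  rewrite -lecR; apply: le_trans (xM A).
  by rewrite !partial_sumE -real_complex_sum; apply: ler_sum => i _; exact: ple.
have /cvg_ex[/= a xa] := part_cvg (@complex.Re R) (@normc_ge_Re R).
have /cvg_ex[/= b xb] := part_cvg (@complex.Im R) normc_ge_Im.
apply/(@cvg_ex C); exists (a%:C%C + 'i%C * b%:C%C).
rewrite (_ : partial_sum x = fun A =>
  (partial_sum (@complex.Re R \o x) A)%:C%C +
  'i%C * (partial_sum (@complex.Im R \o x) A)%:C%C); last first.
  apply/funext => A; rewrite !partial_sumE -!real_complex_sum mulr_sumr.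
  by rewrite -big_split; apply: eq_bigr => i _; exact: complexE.
apply: cvgD; first exact: cvg_real_complex.
by apply: cvgM; [exact: cvg_cst|exact: cvg_real_complex].
Qed.

Lemma cvg_expr_complex z : `|z| < 1 -> (fun n => z ^+ n) @ \oo --> 0.
Proof.
move=> z1; apply: norm_cvg0.
rewrite (_ : (fun n => _) = fun n => (complex.Re `|z| ^+ n)%:C%C); last first.
  by apply/funext => n; rewrite normrX -[in LHS]Re_normK rmorphXn.
apply: cvg_real_complex; apply: cvg_expr.
by rewrite -ltcR -normc_real Re_normK normr_id.
Qed.

End complex.

(** * Bounding the products of the 1 / (1 - |a_n|) *)

(** The last hypothesis gives (1 - s)(1 - t) >= 1 - 2t, and (1 + t)^2 (1 - 2t) - (1 - t) = t (1 - 3t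
    - 2t^2) is nonnegative for t <= 1/4. *)
Lemma inv_subr_le_sqr (R : realFieldType) (s t : R) : 0 <= s < 1 ->
  0 <= t <= 4^-1 -> s * (1 - t) <= t -> (1 - s)^-1 <= (1 + t) ^+ 2.
Proof.
move=> /andP[s0 s1] /andP[t0 t4] st; rewrite -[leLHS]mul1r.
rewrite ler_pdivrMr; last lra.
have t1 : 0 < 1 - t by lra.
rewrite -(ler_pM2r t1).
have : (1 + t) ^+ 2 * (1 - 2 * t) <= (1 + t) ^+ 2 * (1 - s) * (1 - t).
  rewrite -mulrA ler_wpM2l ?sqr_ge0 //; nra.
have : 0 <= t * (1 - 3 * t - 2 * t ^+ 2) by apply: mulr_ge0 => //; nra.
nra.
Qed.

(** From [n0] on, consecutive products of the [1 + t i] differ by at most 1/4, hence [t n <= 4^-1]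
    and [inv_subr_le_sqr] applies: [Q] then grows no faster than [P ^+ 2], which stays below
    [(c + 8^-1) ^+ 2]. *)
Lemma prod_inv_subr_bounded (R : realFieldType) (s t : nat -> R) (c : R)
    (n0 : nat) :
  (forall n, 0 <= s n < 1) -> (forall n, 0 <= t n) ->
  (forall n, s n * (1 - t n) <= t n) ->
  (forall n, (n0 <= n)%N -> `|c - \prod_(i < n) (1 + t i)| <= 8^-1) ->
  exists B, forall N, \prod_(i < N) (1 - s i)^-1 <= B.
Proof.
move=> s01 t0 st; set P := fun n => \prod_(i < n) (1 + t i) => Pc.
pose Q n := \prod_(i < n) (1 - s i)^-1.
have PS n : P n.+1 = P n * (1 + t n) by rewrite /P big_ord_recr.
have P1 n : 1 <= P n.
  elim: n => [|n IHn]; first by rewrite /P big_ord0.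
  by rewrite PS mulr_ege1 // lerDl.
have Q_ge0 n : 0 <= Q n.
  by apply: prodr_ge0 => i _; have := s01 i; rewrite invr_ge0; lra.
have QS n : Q n.+1 = Q n * (1 - s n)^-1 by rewrite /Q big_ord_recr.
have t4 n : (n0 <= n)%N -> t n <= 4^-1.
  (* [P n.+1 - P n = P n * t n] with [1 <= P n]. *)
  move=> n0n; have := Pc _ n0n; have := Pc _ (leqW n0n).
  rewrite -/(P n) -/(P n.+1) PS !ler_norml => /andP[? ?] /andP[? ?].
  have := ler_peMl (t0 n) (P1 n); nra.
have QP k : Q (n0 + k)%N <= Q n0 * P (n0 + k)%N ^+ 2.
  elim: k => [|k IHk].
    by rewrite addn0 ler_peMr //; have := P1 n0; nra.
  rewrite addnS QS PS exprMn mulrA ler_pM // ?invr_ge0.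
    by have := s01 (n0 + k)%N; lra.
  by apply: inv_subr_le_sqr => //; rewrite t0 t4 ?leq_addr.
exists (Q n0 * (c + 8^-1) ^+ 2) => N; rewrite -/(Q N).
(* [Q] is nondecreasing, so small [N] need no separate treatment. *)
have QN : Q N <= Q (n0 + N)%N.
  rewrite addnC; elim: n0 {Pc t4 QP} => [|k IHk]; first by rewrite addn0.
  rewrite addnS QS; apply: le_trans IHk _; rewrite ler_peMr // invf_ge1.
    by have := s01 (N + k)%N; lra.
  by have := s01 (N + k)%N; lra.
apply: le_trans QN _; apply: le_trans (QP N) _; apply: ler_wpM2l => //.
have := Pc _ (leq_addr N n0); have := P1 (n0 + N)%N.
rewrite -/(P _) ler_norml => ? /andP[? ?].
by apply: lerXn2r; rewrite ?nnegrE; lra.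
Qed.

Lemma partial_prodE (K : numFieldType) (u : nat -> K) (N : nat) :
  partial_prod u N = \prod_(i < N) u i.+1.
Proof. by rewrite /partial_prod big_add1 big_mkord. Qed.

(** With w = a / (1 - a), one has a = w - w a; take absolute values. *)
Lemma norm_le_inv_subr (K : numFieldType) (a : K) : `|a| < 1 ->
  `|a| * (1 - `|(1 - a)^-1 - 1|) <= `|(1 - a)^-1 - 1|.
Proof.
move=> /subr_norm_lt1_neq0 a_neq1; set w := (1 - a)^-1 - 1.
have aE : a = w - w * a by rewrite /w; field.
rewrite mulrBr mulr1 lerBlDr mulrC -normrM {1}aE.
exact: ler_normB.
Qed.

Lemma prod_geometric_bounded (R : realType) (a : nat -> (R[i] : numFieldType)) :
  (forall n, `|a n| < 1) ->
  cvgn (fun N => \prod_(i < N) (1 + `|(1 - a i)^-1 - 1|)) ->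
  exists B : R, forall N, \prod_(i < N) (1 - `|a i|)^-1 <= B%:C%C.
Proof.
move=> a_lt1 /(@cvg_ex (R[i] : numFieldType))[L].
move=> /(@cvgrPdist_le _ (R[i] : numFieldType)) PL.
pose s n := complex.Re `|a n|; pose t n := complex.Re `|(1 - a n)^-1 - 1|.
have e_gt0 : (0 : R[i] : numFieldType) < (8^-1 : R)%:C%C by rewrite ltcR; lra.
have [n0 _ Pn0] := PL _ e_gt0.
have [B QB] : exists B, forall N, \prod_(i < N) (1 - s i)^-1 <= B.
  apply: (@prod_inv_subr_bounded _ s t (complex.Re L) n0) => n.
  - by rewrite Re_norm_ge0 Re_norm_lt1.
  - exact: Re_norm_ge0.
  - by rewrite -lecR rmorphM rmorphB !Re_normK norm_le_inv_subr.
  - move=> /Pn0 /=; rewrite -lecR; apply: le_trans.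
    apply: le_trans (normc_ge_Re _); rewrite raddfB.
    rewrite (_ : \prod_(i < n) _ = (\prod_(i < n) (1 + t i))%:C%C) //.
    rewrite rmorph_prod; apply: eq_bigr => i _.
    by rewrite -[in LHS]Re_normK rmorphD.
exists B => N.
rewrite (_ : \prod_(i < N) _ = (\prod_(i < N) (1 - s i)^-1)%:C%C).
  by rewrite lecR.
rewrite rmorph_prod; apply: eq_bigr => i _.
by rewrite -[in LHS]Re_normK fmorphV rmorphB.
Qed.

(** * The sum over partitions and the product *)

(** Enlarge [A] to a box, where the absolute sum factors into truncated geometric series. *)
Lemma partial_sum_norm_le (K : numFieldType) (a : nat -> K)
    (F : seqcong -> K) (B : K) :
  (forall i, `|a i| < 1) ->
  (forall N (l : seqcong), (size (val l) <= N)%N ->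
    F l = \prod_(i < N) a i ^+ mult (val l) i) ->
  (forall N, \prod_(i < N) (1 - `|a i|)^-1 <= B) ->
  forall A, partial_sum (fun l => `|F l|) A <= B.
Proof.
move=> a_lt1 FE prodB A; have [M AM] := fsubset_box A.
apply: le_trans (ler_partial_sum _ (AM M M _ _)) _ => //.
rewrite (sum_box (a := fun i => `|a i|)); last first.
  move=> l lM; rewrite (FE _ _ lM) normr_prod.
  by apply: eq_bigr => i _; rewrite normrX.
apply: le_trans (prodB M); apply: ler_prod => i _.
rewrite sumr_ge0 => [|k _]; last exact: exprn_ge0.
rewrite sum_geometric ?normr_id // ler_piMl ?gerBl ?exprn_ge0 //.
by rewrite invr_ge0 subr_ge0 ltW.
Qed.

Lemma cvg_prod_inv_subr (K : numFieldType) (a : nat -> K)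
    (F : seqcong -> K) (S : K) :
  (forall i, `|a i| < 1) ->
  (forall N (l : seqcong), (size (val l) <= N)%N ->
    F l = \prod_(i < N) a i ^+ mult (val l) i) ->
  (forall i, (fun n => a i ^+ n) @ \oo --> 0) ->
  partial_sum F @ totally --> S ->
  (fun N => \prod_(i < N) (1 - a i)^-1) @ \oo --> S.
Proof.
move=> a_lt1 FE a0 /cvgrPdist_le FS; apply/cvgrPdist_le => e e_gt0.
have /near_totally[A0 A0S] := FS _ (divr_gt0 e_gt0 (ltr0n _ 2)).
have [M A0M] := fsubset_box A0; exists M => // N MN /=.
have : (fun n => \prod_(i < N) \sum_(k < n.+1) a i ^+ k) @ \oo -->
    \prod_(i < N) (1 - a i)^-1.
  apply: cvg_big => [|i _]; first exact: mul_continuous.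
  exact: cvg_sum_geometric.
move=> /cvgrPdist_le /(_ _ (divr_gt0 e_gt0 (ltr0n _ 2)))[n0 _ n0P].
(* The exponent bound is chosen after [N]: [n0] makes the truncated product close to the full one,
   [M] makes the box contain [A0]. *)
have /= := n0P (maxn n0 M) (leq_maxl _ _); rewrite -(sum_box _ (FE N)).
have := A0S _ (A0M _ _ MN (leq_maxr n0 M)).
set T := partial_sum _ _ => ST PT.
rewrite [e]splitr; apply: le_trans (ler_distD T _ _) _.
by rewrite lerD // distrC.
Qed.

(** [geometric] makes every factor the sum of its geometric series. If [f 1 * q = 2] and the other
    [f n * q ^+ n] with n >= 1 vanish, the product is -1 but the sum over partitions diverges. *)
Theorem theorem2p2 (R : realType) (f : nat -> R[i]) (q : R[i])
    (abs_cvg : abs_cvg_prod (fun n => (1 - f n * q ^+ n)^-1))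
    (geometric : forall n : nat, (1 <= n)%N -> `|f n * q ^+ n| < 1) :
  let factor n := (1 - f n * q ^+ n)^-1 in
  let term (l : seqcong) := weight f q (val l) in
  [/\ cvgn (partial_prod factor),
      cvg (partial_sum term @ totally)
    & inf_prod factor = sum term].
Proof.
move=> factor term; pose a n : (R[i] : numFieldType) := f n.+1 * q ^+ n.+1.
have a_lt1 n : `|a n| < 1 by exact: geometric.
have termE N (l : seqcong) : (size (val l) <= N)%N ->
    term l = \prod_(i < N) a i ^+ mult (val l) i.
  by move=> lN; rewrite /term (weightE f q (valP l) lN).
have [B prodB] : exists B : R,
    forall N, \prod_(i < N) (1 - `|a i|)^-1 <= B%:C%C.
  apply: prod_geometric_bounded; first exact: a_lt1.
  pose u n := 1 + `|(1 - f n * q ^+ n)^-1 - 1|.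
  rewrite (_ : (fun N => _) = partial_prod u).
    exact: abs_cvg.
  by apply/funext => N; rewrite partial_prodE.
have cvg_term : cvg (partial_sum term @ totally).
  apply: (bounded_sums_cvg (M := B)) => A.
  exact: (partial_sum_norm_le a_lt1 termE).
have prod_cvg : partial_prod factor @ \oo --> sum term.
  rewrite (_ : partial_prod factor = fun N => \prod_(i < N) (1 - a i)^-1).
    apply: (cvg_prod_inv_subr a_lt1 termE) => [i|].
      exact: cvg_expr_complex (a_lt1 i).
    exact: cvg_term.
  by apply/funext => N; rewrite partial_prodE.
split; [by apply/cvg_ex; exists (sum term) | exact: cvg_term |].
by apply: cvg_lim; [exact: norm_hausdorff | exact: prod_cvg].
Qed.
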